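(* Let $(g_n)_{n\ge 1}$ and $(h_n)_{n\ge 1}$ be sequences of complex numbers with $g_n\neq 0$ for all $n$, and put $g_0=1$. Let $P_n(x),Q_n(x)$ be the numerators and denominators of the convergents of the continued fraction $$1-\cfrac{h_1 x}{g_1+h_1 x-\cfrac{g_1 h_2 x}{g_2+h_2 x-\cfrac{g_2 h_3 x}{g_3+h_3 x-\ddots}}}\,,$$ that is, $P_{-1}(x)=1$, $Q_{-1}(x)=0$, $P_0(x)=Q_0(x)=1$ and, for $n\ge 1$, $$P_n(x)=(g_n+h_n x)P_{n-1}(x)-g_{n-1}h_n x\,P_{n-2}(x),\qquad Q_n(x)=(g_n+h_n x)Q_{n-1}(x)-g_{n-1}h_n x\,Q_{n-2}(x).$$ Then for all $n\ge 0$ $$P_n(x)=g_1\cdots g_n,\qquad Q_n(x)=g_1\cdots g_n\sum_{j=0}^n\frac{h_1\cdots h_j}{g_1\cdots g_j}x^j .$$ Consequently the formal power series $$f(x)=\left(\sum_{j=0}^\infty\frac{h_1\cdots h_j}{g_1\cdots g_j}x^j\right)^{-1}$$ has the continued fraction $$1-\cfrac{h_1 x}{g_1+h_1 x-\cfrac{g_1 h_2 x}{g_2+h_2 x-\cfrac{g_2 h_3 x}{g_3+h_3 x-\ddots}}}$$ as an expansion: for every $n\ge 0$, $P_n(x)/Q_n(x)\equiv f(x)\pmod{x^{n+1}}$.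
   Context: Empty products are equal to $1$, i.e. $g_1\cdots g_j=h_1\cdots h_j=1$ when $j=0$. The congruence modulo $x^{n+1}$ means that the power series expansions at $x=0$ of the two sides agree up to and including the term in $x^n$. *)

(* Defs.v *)
From HB Require Import structures.
From mathcomp Require Import all_boot all_order all_algebra.
From mathcomp Require Import reals complex.

Set Implicit Arguments.
Unset Strict Implicit.
Unset Printing Implicit Defensive.

Import Order.TTheory GRing.Theory Num.Theory.
Local Open Scope ring_scope.

(* Formal power series, represented by their sequences of coefficients. *)
Section FormalPowerSeries.
Variable F : fieldType.

Definition fps := nat -> F.

Definition fps_of_poly (p : {poly F}) : fps := fun n => p`_n.

Definition fps_mul (u v : fps) : fps :=
  fun n => \sum_(i < n.+1) u i * v (n - i)%N.

Fixpoint fps_inv_coefs (u : fps) (n : nat) : seq F :=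
  if n is m.+1 then
    let s := fps_inv_coefs u m in
    rcons s ((u 0%N)^-1 * ((m == 0%N)%:R - \sum_(i < m) u (m - i)%N * s`_i))
  else [::].

(* The multiplicative inverse, obtained by solving u * v = 1 coefficient by
   coefficient; meaningful when u 0 != 0, see fps_mulV. *)
Definition fps_inv (u : fps) : fps := fun n => (fps_inv_coefs u n.+1)`_n.

Definition fps_div (u v : fps) : fps := fps_mul u (fps_inv v).

(* u = v mod x^m *)
Definition fps_eqmod (m : nat) (u v : fps) : Prop :=
  forall i, (i < m)%N -> u i = v i.

Lemma size_fps_inv_coefs u n : size (fps_inv_coefs u n) = n.
Proof. by elim: n => //= n IHn; rewrite size_rcons IHn. Qed.

Lemma nth_fps_inv_coefs u n i :
  (i < n)%N -> (fps_inv_coefs u n)`_i = fps_inv u i.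
Proof.
elim: n => // n IHn; rewrite ltnS leq_eqVlt => /predU1P[-> //|lt_in].
by rewrite /= nth_rcons size_fps_inv_coefs lt_in IHn.
Qed.

Lemma fps_mulV u n : u 0%N != 0 -> fps_mul u (fps_inv u) n = (n == 0%N)%:R.
Proof.
move=> u0; rewrite /fps_mul big_ord_recl /= subn0 {1}/fps_inv /=.
rewrite nth_rcons size_fps_inv_coefs ltnn eqxx mulrA mulfV // mul1r.
apply/eqP; rewrite addrC addrCA -subr_eq0 addrAC addrC subrr addr0 subr_eq0.
apply/eqP; rewrite (reindex_inj rev_ord_inj) /=; apply: eq_bigr => i _.
have lt_in := ltn_ord i.
rewrite /bump /= add1n subnSK // (nth_fps_inv_coefs _ lt_in).
by congr (u _ * fps_inv u _); rewrite ?subKn // ltnW.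
Qed.

End FormalPowerSeries.

(* The continued fraction b 0 + a 1 / (b 1 + a 2 / (b 2 + ...)); the value a 0
   is not used. *)
Section ContinuedFractions.
Variable A : pzRingType.
Implicit Types a b : nat -> A.

(* The pair (X_{n-1}, X_n), where X_{-1} = u, X_0 = v and
   X_n = b n * X_{n-1} + a n * X_{n-2} for n >= 1. *)
Fixpoint cf_pair a b (u v : A) (n : nat) : A * A :=
  if n is m.+1 then
    let: (y, z) := cf_pair a b u v m in (z, b n * z + a n * y)
  else (u, v).

(* Numerators and denominators of the convergents. *)
Definition cf_num a b (n : nat) : A := (cf_pair a b 1 (b 0%N) n).2.
Definition cf_den a b (n : nat) : A := (cf_pair a b 0 1 n).2.

Lemma cf_pairS a b u v n :
  cf_pair a b u v n.+1 =
  ((cf_pair a b u v n).2,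
   b n.+1 * (cf_pair a b u v n).2 + a n.+1 * (cf_pair a b u v n).1).
Proof. by rewrite /=; case: cf_pair. Qed.

Lemma cf_num0 a b : cf_num a b 0 = b 0%N. Proof. by []. Qed.
Lemma cf_den0 a b : cf_den a b 0 = 1. Proof. by []. Qed.

Lemma cf_num1 a b : cf_num a b 1 = b 1%N * cf_num a b 0 + a 1%N * 1.
Proof. by []. Qed.

Lemma cf_den1 a b : cf_den a b 1 = b 1%N * cf_den a b 0 + a 1%N * 0.
Proof. by []. Qed.

Lemma cf_numSS a b n :
  cf_num a b n.+2 = b n.+2 * cf_num a b n.+1 + a n.+2 * cf_num a b n.
Proof. by rewrite /cf_num !cf_pairS. Qed.

Lemma cf_denSS a b n :
  cf_den a b n.+2 = b n.+2 * cf_den a b n.+1 + a n.+2 * cf_den a b n.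
Proof. by rewrite /cf_den !cf_pairS. Qed.

End ContinuedFractions.

Section Expansion.
Variable F : fieldType.

(* The power series expansion at 0 of the n-th convergent agrees with f modulo
   x^{n+1}, for every n. *)
Definition cf_expansion (f : fps F) (a b : nat -> {poly F}) : Prop :=
  forall n : nat,
    fps_eqmod n.+1
      (fps_div (fps_of_poly (cf_num a b n)) (fps_of_poly (cf_den a b n))) f.

Variables g h : nat -> F.

(* With g 0 = 1, the continued fraction
   1 - h_1 x / (g_1 + h_1 x - g_1 h_2 x / (g_2 + h_2 x - ...)). *)
Definition gh_partial_num (n : nat) : {poly F} := - ((g n.-1 * h n) *: 'X).
Definition gh_partial_den (n : nat) : {poly F} :=
  if n is 0%N then 1 else (g n)%:P + h n *: 'X.

End Expansion.

(* Main.v *)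
(** Write G_n and H_n for the products g_1...g_n and h_1...h_n. In the
    recurrence for P_n the terms in x cancel. For Q_n the three-term recurrence
    collapses to Q_{n+1} = g_{n+1} Q_n + H_{n+1} x^{n+1}, which sums to the stated
    formula. Hence the coefficients of Q_n up to x^n are those of the series c
    scaled by P_n = G_n, and P_n / Q_n inverts c modulo x^{n+1}. *)

Require Import Defs.
From HB Require Import structures.
From mathcomp Require Import all_boot all_order all_algebra.
From mathcomp Require Import reals complex.
From mathcomp Require Import ring.

Set Implicit Arguments.
Unset Strict Implicit.
Unset Printing Implicit Defensive.

Import Order.TTheory GRing.Theory Num.Theory.
Local Open Scope ring_scope.

(* Comparing coefficients of x^k in u v = 1 determines v k from the lower
   coefficients, so inverses agree as far as the products with u do. *)
Lemma fps_inv_unique (F : fieldType) (u v : fps F) n : u 0%N != 0 ->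
  fps_eqmod n (fps_mul u v) (fun k => (k == 0%N)%:R) ->
  fps_eqmod n v (fps_inv u).
Proof.
move=> u0 uv1 k; elim/ltn_ind: k => k IHk lt_kn.
have := uv1 k lt_kn; rewrite -(fps_mulV k u0) /fps_mul !big_ord_recl /= !subn0.
have -> : \sum_(i < k) u (bump 0 i) * v (k - bump 0 i)%N =
          \sum_(i < k) u (bump 0 i) * fps_inv u (k - bump 0 i)%N.
  apply: eq_bigr => i _; rewrite /bump add1n IHk //.
    by rewrite ltn_subrL /= (leq_ltn_trans _ (ltn_ord i)).
  exact: leq_ltn_trans (leq_subr _ _) lt_kn.
by move/addIr/(mulfI u0).
Qed.

Lemma fps_mul_polyC (F : fieldType) (a : F) (v : fps F) n :
  fps_mul (fps_of_poly a%:P) v n = a * v n.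
Proof.
rewrite /fps_mul big_ord_recl /fps_of_poly coefC /= subn0 big1 ?addr0 // => i _.
by rewrite coefC mul0r.
Qed.

Section GHContinuedFraction.
Variables (F : fieldType) (g h : nat -> F).
Hypotheses (g_neq0 : forall n, (1 <= n)%N -> g n != 0) (g0 : g 0%N = 1).

Let a := gh_partial_num g h.
Let b := gh_partial_den g h.
Let G n := \prod_(1 <= i < n.+1) g i.
Let H n := \prod_(1 <= i < n.+1) h i.

Let G0 : G 0 = 1. Proof. by rewrite /G big_geq. Qed.
Let H0 : H 0 = 1. Proof. by rewrite /H big_geq. Qed.
Let GS n : G n.+1 = G n * g n.+1. Proof. by rewrite /G big_nat_recr. Qed.
Let HS n : H n.+1 = H n * h n.+1. Proof. by rewrite /H big_nat_recr. Qed.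

Let G_neq0 n : G n != 0.
Proof.
by elim: n => [|n IHn]; rewrite ?G0 ?oner_eq0 // GS mulf_neq0 ?g_neq0.
Qed.

Let aS n : a n.+1 = - ((g n)%:P * (h n.+1)%:P * 'X).
Proof. by rewrite /a /gh_partial_num -mul_polyC polyCM. Qed.

Let bS n : b n.+1 = (g n.+1)%:P + (h n.+1)%:P * 'X.
Proof. by rewrite /b /= -mul_polyC. Qed.

Lemma gh_cf_num n : cf_num a b n = (G n)%:P.
Proof.
elim/ltn_ind: n => -[|[|n]] IHn; first by rewrite cf_num0 G0.
  (* The normalisation g_0 = 1 lets the term - g_0 h_1 x cancel h_1 x. *)
  by rewrite cf_num1 cf_num0 aS bS g0 GS G0 !mul1r !mulr1 addrK.
rewrite cf_numSS !IHn // aS bS !GS !polyCM.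
by ring.
Qed.

(** The recurrence rearranges to Q_{n+2} - g_{n+2} Q_{n+1} = h_{n+2} x (Q_{n+1} - g_{n+1} Q_n), so
    the defect gains one factor h_{n+2} x per step, starting from Q_1 - g_1 Q_0 = h_1 x. *)
Lemma gh_cf_denS n :
  cf_den a b n.+1 = g n.+1 *: cf_den a b n + H n.+1 *: 'X^(n.+1).
Proof.
elim: n => [|n IHn].
  by rewrite cf_den1 cf_den0 bS HS H0 mul1r mulr0 addr0 mulr1 alg_polyC
             mul_polyC.
rewrite cf_denSS aS bS IHn !HS -!mul_polyC !polyCM (exprS _ n.+1).
by ring.
Qed.

Lemma gh_cf_den n :
  cf_den a b n = G n *: \sum_(0 <= j < n.+1) (H j / G j) *: 'X^j.
Proof.
elim: n => [|n IHn].
  by rewrite cf_den0 big_nat1 G0 H0 divr1 !scale1r.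
rewrite gh_cf_denS IHn [in RHS]big_nat_recr //= scalerDr !scalerA.
by rewrite [G n.+1 * _]mulrC divfK // GS [g _ * _]mulrC.
Qed.

Lemma gh_cf_expansion : cf_expansion (fps_inv (fun j => H j / G j)) a b.
Proof.
move=> n; apply: fps_inv_unique; first by rewrite H0 G0 divr1 oner_eq0.
have Qcoef i : (i < n.+1)%N -> (cf_den a b n)`_i = G n * (H i / G i).
  move=> lt_in; rewrite gh_cf_den coefZ big_mkord.
  by rewrite -(poly_def _ (fun j => H j / G j)) coef_poly lt_in.
(* The constant term of Q_n is G_n, so [fps_inv] yields a genuine inverse of Q_n. *)
have Q0 : fps_of_poly (cf_den a b n) 0%N != 0.
  by rewrite /fps_of_poly Qcoef // H0 G0 divr1 mulr1.
(* With 1 written as Q_n * Q_n^{-1}, the two convolutions agree term by term: the factor G_n = P_n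
   moves onto c_i, and G_n c_i is the coefficient of x^i in Q_n since i <= k <= n. *)
move=> k lt_kn; rewrite -(fps_mulV k Q0); apply: eq_bigr => i _.
rewrite gh_cf_num /fps_div fps_mul_polyC /fps_of_poly Qcoef.
  by rewrite mulrCA mulrA.
exact: leq_trans (ltn_ord i) lt_kn.
Qed.

End GHContinuedFraction.

Theorem mainTheorem1 (R : realType) (g h : nat -> R[i])
    (g_neq0 : forall n : nat, (1 <= n)%N -> g n != 0)
    (g0 : g 0%N = 1) :
  let a := gh_partial_num g h in
  let b := gh_partial_den g h in
  let P := cf_num a b in
  let Q := cf_den a b in
  let c := fun j : nat =>
    (\prod_(1 <= i < j.+1) h i) / (\prod_(1 <= i < j.+1) g i) in
  [/\ forall n : nat, P n = (\prod_(1 <= i < n.+1) g i)%:P,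
      forall n : nat,
        Q n = (\prod_(1 <= i < n.+1) g i) *: \sum_(0 <= j < n.+1) c j *: 'X^j
    & cf_expansion (fps_inv c) a b].
Proof.
split=> [n|n|]; [exact: gh_cf_num|exact: gh_cf_den|exact: gh_cf_expansion].
Qed.
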